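(* Let $N\ge 1$, let $Z_1=(X_1,Y_1),\dots,Z_{N+1}=(X_{N+1},Y_{N+1})$ be independent random variables with values in $\mathcal X\times\mathcal Y$, $Z_k\sim P^k$, let $P^{\mathrm{cal}}=\frac1N\sum_{k=1}^N P^k$ and assume $P^{N+1}\ll P^{\mathrm{cal}}$. Let $\lambda=\frac{\mathrm dP^{N+1}}{\mathrm dP^{\mathrm{cal}}}$, $V_k=V(Z_k)$, and let $\alpha\in(0,1)$. Assume that almost surely there are no ties between the elements of $\{V_k\}_{k\in\{1,\dots,N+1\}}\cup\{\infty\}$. Assume that there is $\sigma\ge0$ such that for every $v\in\mathbb R$ the random variable $\lambda(Z)\mathbf 1_{V(Z)<v}-\mathbb E[\lambda(Z)\mathbf 1_{V(Z)<v}]$, where $Z\sim P^{\mathrm{cal}}$, is sub-Gaussian with parameter $\sigma$. Then $$\left|\mathbb E[\alpha(\mathcal D_N)]-\alpha\right|\le 19\,\sigma\sqrt{\frac{\log 4N}{N}}+\frac{18\,\mathbb E[\lambda^2(Z_{N+1})]}{N}.$$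
   Context: $V:\mathcal X\times\mathcal Y\to[0,\infty)$ is a fixed measurable (non-conformity score) function; $\lambda$ takes values in $[0,\infty)$. A real random variable $W$ is sub-Gaussian with parameter $\sigma\ge0$ if $\mathbb E[e^{tW}]\le e^{t^2\sigma^2/2}$ for all $t\in\mathbb R$. For a probability measure $\mu$ on $\mathbb R\cup\{\infty\}$ and $\beta\in[0,1]$, $Q_\beta(\mu)=\inf\{v:\mu((-\infty,v])\ge\beta\}$ is its $\beta$-quantile ($+\infty$ if no finite $v$ qualifies). $\delta_v$ is the Dirac mass at $v$. $\mathcal D_N=\{Z_k\}_{k=1}^N$ and $\lambda_k=\lambda(Z_k)$. For $(x,y)\in\mathcal X\times\mathcal Y$ define $$p_k^{(x,y)}=\frac{\lambda_k}{\lambda(x,y)+\sum_{l=1}^N\lambda_l}\ (1\le k\le N),\qquad p_{N+1}^{(x,y)}=\frac{\lambda(x,y)}{\lambda(x,y)+\sum_{l=1}^N\lambda_l},$$ $$\mu^{(x,y)}=\sum_{k=1}^N p_k^{(x,y)}\delta_{V_k}+p_{N+1}^{(x,y)}\delta_\infty ,\qquad \mathcal C_{\alpha,\mu}(x)=\{y\in\mathcal Y: V(x,y)\le Q_{1-\alpha}(\mu^{(x,y)})\}.$$ The denominators are almost surely positive at $(x,y)=Z_{N+1}$. The conditional miscoverage rate is $\alpha(\mathcal D_N)=\mathbb P\left(Y_{N+1}\notin\mathcal C_{\alpha,\mu}(X_{N+1})\mid\mathcal D_N\right)$. *)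

(* Defs.v *)
From HB Require Import structures.
From mathcomp Require Import all_boot all_order all_algebra.
From mathcomp Require Import all_classical all_reals all_analysis.
From mathcomp Require Import measurable_realfun.

Set Implicit Arguments.
Unset Strict Implicit.
Unset Printing Implicit Defensive.

Import Order.TTheory GRing.Theory Num.Theory.
Import numFieldNormedType.Exports.

Local Open Scope classical_set_scope.
Local Open Scope ring_scope.
Local Open Scope ereal_scope.

Definition mutually_independent d d' (Omega : measurableType d)
    (T : measurableType d') (R : realType) (P : probability Omega R)
    (I : finType) (Z : I -> Omega -> T) : Prop :=
  forall (J : {set I}) (A : I -> set T),
    (forall i, i \in J -> measurable (A i)) ->
    P (\bigcap_(i in [set` J]) (Z i @^-1` A i)) =
    \prod_(i in J) P (Z i @^-1` A i).

Definition generated_sigma_algebra d' (Omega : Type) (T : measurableType d')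
    (I : Type) (Z : I -> Omega -> T) : set (set Omega) :=
  <<s \bigcup_i preimage_set_system setT (Z i) measurable >>.

(* [g] is a version of the conditional probability of the event [E] given the
   sub-sigma-algebra [F] *)
Definition is_cond_probability d (Omega : measurableType d) (R : realType)
    (P : probability Omega R) (F : set (set Omega)) (E : set Omega)
    (g : Omega -> R) : Prop :=
  [/\ forall B : set R, measurable B -> F (g @^-1` B),
      P.-integrable setT (EFin \o g) &
      forall A, F A -> \int[P]_(w in A) (g w)%:E = P (A `&` E)].

Definition sub_gaussian d (T : measurableType d) (R : realType)
    (P : probability T R) (W : T -> R) (sigma : R) : Prop :=
  (0 <= sigma)%R /\
  forall t : R, 'M_P W t <= (expR (t ^+ 2 * sigma ^+ 2 / 2))%:E.

(* The positivity of [N] is an argument only so that the average below can be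
   given its probability structure. *)
Definition average d (T : measurableType d) (R : realType) (N : nat)
    (hN : (0 < N)%N) (Q : 'I_N -> probability T R) : set T -> \bar R :=
  fun A => (N%:R^-1)%:E * \sum_(k < N) Q k A.

Section average_probability.
Context d (T : measurableType d) (R : realType) (N : nat) (hN : (0 < N)%N)
  (Q : 'I_N -> probability T R).

Let average0 : average hN Q set0 = 0.
Proof. by rewrite /average big1 ?mule0. Qed.

Let average_ge0 A : 0 <= average hN Q A.
Proof. by rewrite /average mule_ge0 ?lee_fin// sume_ge0. Qed.

Let average_sigma_additive : semi_sigma_additive (average hN Q).
Proof.
move=> F mF tF mUF; rewrite /average.
rewrite [X in X @ \oo --> _](_ : _ = (fun n =>
    (N%:R^-1)%:E * \sum_(k < N) \sum_(0 <= i < n) Q k (F i))); last first.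
  apply/funext => n; rewrite -ge0_sume_distrr; last by move=> *; exact: sume_ge0.
  by rewrite exchange_big.
apply: cvgeZl => //; apply: cvg_nnesum => k _.
  by near=> n; exact: sume_ge0.
exact: measure_semi_sigma_additive.
Unshelve. all: by end_near. Qed.

HB.instance Definition _ := isMeasure.Build _ _ _ (average hN Q)
  average0 average_ge0 average_sigma_additive.

Let average_setT : average hN Q setT = 1.
Proof.
rewrite /average (eq_bigr (fun=> 1%:E)); last first.
  by move=> k _; exact: probability_setT.
rewrite sumEFin sumr_const card_ord -EFinM mulVf// pnatr_eq0 -lt0n//.
Qed.

HB.instance Definition _ :=
  Measure_isProbability.Build _ _ _ (average hN Q) average_setT.

End average_probability.

(* Measures on R u {+oo} are represented on [\bar R], with no mass at [-oo];
   the infimum of the empty set is [+oo]. *)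
Definition quantile (R : realType) (beta : R) (mu : set (\bar R) -> \bar R) :
    \bar R :=
  ereal_inf [set v%:E | v in
    [set v : R | beta%:E <= mu [set u : \bar R | -oo < u <= v%:E]]].

Section conformal.
Context (R : realType) (X Y : Type) (N : nat).
Variables (V lambda : X * Y -> R) (D : 'I_N -> X * Y).

(* A zero denominator gives zero weights; at the test point this has
   probability zero. *)
Definition weight (z z' : X * Y) : R :=
  (lambda z' / (lambda z + \sum_(l < N) lambda (D l)))%R.

Definition weighted_score_law (z : X * Y) : set (\bar R) -> \bar R :=
  fun A => \sum_(k < N) (weight z (D k))%:E * \d_((V (D k))%:E) A
    + (weight z z)%:E * \d_(+oo) A.

Definition confidence_set (alpha : R) (x : X) : set Y :=
  [set y | (V (x, y))%:E <=
           quantile (1 - alpha) (weighted_score_law (x, y))].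

End conformal.

Definition calibration (N : nat) (T : Type) (z : 'I_N.+1 -> T) : 'I_N -> T :=
  fun k => z (widen_ord (leqnSn N) k).

(* Main.v *)
Require Import Defs.
From HB Require Import structures.
From mathcomp Require Import all_boot all_order all_algebra.
From mathcomp Require Import all_classical all_reals all_analysis.
From mathcomp Require Import measurable_realfun.
From mathcomp Require Import ring lra.

(* Write [F v] for the law of the test score, [F v = E_cal[lambda 1_{V < v}]], and
   [F_N v] for its empirical version [1/N sum_k lambda_k 1_{V_k < v}]. Up to a
   zero denominator, the test point is not covered iff
   [F_N (V_{N+1}) >= (1 - alpha) (lambda_{N+1} / N + F_N oo)]. Since [F] is
   continuous, there is a fixed level [v] with [F v = s] for any [0 < s < 1], and
   by monotonicity of [F_N] miscoverage together with [V_{N+1} < v] forces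
   [F_N v] or [F_N oo] to deviate from its mean when [s] is a bit smaller than
   [1 - alpha]; symmetrically, coverage together with [V_{N+1} >= v] forces a
   deviation, or a large [lambda_{N+1}], when [s] is a bit larger. So
   only concentration at two fixed levels is needed, with neither a uniform bound
   nor conditioning on the calibration sample. A large [lambda_{N+1}] is unlikely
   because the sub-Gaussian assumption bounds the variance of [lambda]. *)

Set Implicit Arguments.
Unset Strict Implicit.
Unset Printing Implicit Defensive.

Import Order.TTheory GRing.Theory Num.Theory.
Import numFieldNormedType.Exports.

Local Open Scope classical_set_scope.
Local Open Scope ring_scope.
Local Open Scope charge_scope.
Local Open Scope ereal_scope.

(** * Integration: densities, independent products, averages of laws *)

Section integral_density.
Context d d' (S : measurableType d) (T : measurableType d') (R : realType).
Variables (mu : {measure set S -> \bar R}) (nu : {measure set T -> \bar R}).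
Variables (phi : {mfun S >-> T}) (G : {mfun S >-> R}).
Hypothesis G0 : forall x, (0 <= G x)%R.
Hypothesis nuE : forall A, measurable A ->
  \int[mu]_(x in phi @^-1` A) (G x)%:E = nu A.

Import HBNNSimple.

Let integral_density_nnsfun (h : {nnsfun T >-> R}) :
  \int[mu]_x ((h (phi x))%:E * (G x)%:E) = \int[nu]_y (h y)%:E.
Proof.
have mG : measurable_fun setT (EFin \o G) by exact/measurable_EFinP.
have mh r : measurable (phi @^-1` (h @^-1` [set r])).
  by do 2!apply: measurable_funPTI => //.
transitivity (\int[nu]_x
   (\sum_(y \in range h) (y * \1_(h @^-1` [set y]) x)%:E)); last first.
  by apply: eq_integral => t _; rewrite /= fimfunE -fsumEFin.
rewrite ge0_integral_fsum//; last 2 first.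
  by move=> r; apply/measurable_EFinP; exact: measurable_funM.
  by move=> m y Ey; exact: nnfun_muleindic_ge0.
transitivity (\int[mu]_x (\sum_(y \in range h)
    (y * \1_(h @^-1` [set y]) (phi x))%:E * (G x)%:E)).
  under [RHS]eq_integral => x xE.
    rewrite -ge0_mule_fsuml => [|y]; last exact: nnfun_muleindic_ge0.
    rewrite fsumEFin // -(fimfunE _ (phi x)); over.
  by [].
have mi1 r : measurable_fun setT
    (fun x => \1_(h @^-1` [set r]) (phi x) : R).
  exact: (measurableT_comp (f := \1_(h @^-1` [set r]) : T -> R) (g := phi)).
have mi r : measurable_fun setT
    (fun x => (r * \1_(h @^-1` [set r]) (phi x))%:E : \bar R).
  by apply/measurable_EFinP; exact: measurable_funM.
rewrite ge0_integral_fsum//; last 2 first.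
  - by move=> r; exact: emeasurable_funM.
  - move=> m y _; apply: mule_ge0; last by rewrite lee_fin.
    exact: nnfun_muleindic_ge0.
apply: eq_fsbigr => r rhn.
under [RHS]eq_integral do rewrite EFinM.
rewrite integralZl_indic_nnsfun//.
under eq_integral do rewrite EFinM -muleA.
rewrite ge0_integralZl//.
- congr (_ * _); rewrite integral_indic ?setIT// -nuE//.
  rewrite [RHS]integral_mkcond; apply: eq_integral => x _.
  by rewrite muleC epatch_indic.
- apply: emeasurable_funM => //; exact/measurable_EFinP.
- by move=> t _; rewrite mule_ge0 ?lee_fin.
- by move: rhn; rewrite inE => -[t _ <-]; rewrite lee_fin.
Qed.

(** Level sets reduce simple functions to [nuE]; a general [f] is an increasing limit of simple
    functions, and monotone convergence applies on both sides because [G] is nonnegative. *)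
Lemma integral_density (f : T -> \bar R) : measurable_fun setT f ->
  (forall y, 0 <= f y) ->
  \int[mu]_x (f (phi x) * (G x)%:E) = \int[nu]_y f y.
Proof.
move=> mf f0; pose h := nnsfun_approx measurableT mf.
have hf y : EFin \o h^~ y @ \oo --> f y by exact: cvg_nnsfun_approx.
transitivity (limn (fun n => \int[nu]_y (h n y)%:E)); last first.
  rewrite -monotone_convergence//.
  - by apply: eq_integral => y _; apply/cvg_lim => //; exact: hf.
  - by move=> n; exact/measurable_EFinP/measurable_funP.
  - by move=> n y _; rewrite lee_fin.
  - by move=> y _ m n mn; rewrite lee_fin; exact/lefP/nd_nnsfun_approx.
rewrite -(funext (fun n => integral_density_nnsfun (h n))).
rewrite -monotone_convergence//.
- apply: eq_integral => x _; apply/esym/cvg_lim => //.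
  by apply: cvgeZr => //; exact: hf.
- move=> n; apply: emeasurable_funM; apply/measurable_EFinP => //.
  exact: measurableT_comp.
- by move=> n x _; rewrite mule_ge0 ?lee_fin.
- move=> x _ m n mn; rewrite lee_wpmul2r ?lee_fin//.
  exact/lefP/nd_nnsfun_approx.
Qed.

End integral_density.

(** For indicators this is the definition of independence. The factors are then freed from being
    indicators one at a time: with the others fixed, the left side, as a set function of the
    indicator at [j], is a multiple of the law of [Z j], and [integral_density] passes from sets to
    functions. *)
Lemma mutually_independent_integral_prod d d' (S : measurableType d)
    (T : measurableType d') (R : realType) (P : probability S R) (I : finType)
    (Z : I -> {mfun S >-> T}) (f : I -> {mfun T >-> R}) :
  mutually_independent P (fun i => Z i : S -> T) ->
  (forall i y, (0 <= f i y)%R) ->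
  (forall i, \int[P]_x (f i (Z i x))%:E \is a fin_num) ->
  \int[P]_x (\prod_i f i (Z i x))%:E = \prod_i \int[P]_x (f i (Z i x))%:E.
Proof.
move=> indep f0 ffin.
(* Induction on the list [s] of the indices whose factor is arbitrary; all the others are
   indicators. *)
have Hind (s : seq I) : forall h : I -> {mfun T >-> R},
    (forall i y, (0 <= h i y)%R) ->
    (forall i, \int[P]_x (h i (Z i x))%:E \is a fin_num) ->
    (forall i, i \notin s ->
      exists2 A, measurable A & (h i : T -> R) = \1_A) ->
    \int[P]_x (\prod_i h i (Z i x))%:E = \prod_i \int[P]_x (h i (Z i x))%:E.
  elim: s => [|j s IH] h h0 hfin hA.
    have /choice[A hAE] i : exists A, measurable A /\ (h i : T -> R) = \1_A.
      by have [A mA ->] := hA i isT; exists A.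
    have mZA i : measurable (Z i @^-1` A i).
      rewrite -[X in measurable X]setTI.
      exact: (measurable_funP (Z i) measurableT _ (hAE i).1).
    rewrite [RHS](_ : _ = \prod_(i in [set: I]%SET) P (Z i @^-1` A i)).
      rewrite -(indep [set: I]%SET A)//; last by move=> i _; case: (hAE i).
      rewrite [X in P X](_ : _ = \bigcap_(i in [set: I]) (Z i @^-1` A i)).
        rewrite -[X in P X]setIT -integral_indic//; last first.
          by apply: fin_bigcap_measurable.
        apply: eq_integral => x _; congr _%:E.
        under eq_bigr do rewrite (hAE _).2.
        rewrite !indicE; case: (boolP (x \in _)) => [|/negP].
          rewrite inE => xA; apply: big1 => i _.
          by rewrite indicE mem_set//; exact: xA.
        rewrite inE => /existsNP[i /not_implyP[_ xA]].
        by rewrite (bigD1 i)//= indicE memNset// mul0r.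
      apply: eq_bigcapl; split => i //=.
    rewrite [RHS](eq_bigl xpredT); last by move=> i; rewrite finset.in_setT.
    apply: eq_bigr => i _; under eq_integral do rewrite (hAE _).2.
    rewrite -[X in P X]setIT -integral_indic//.
  pose c := \prod_(i | i != j) \int[P]_x (h i (Z i x))%:E.
  have c0 : 0 <= c.
    apply: prode_ge0 => i _; apply: integral_ge0 => x _.
    by rewrite lee_fin.
  have cfin : c \is a fin_num by apply: prode_fin_num.
  pose G x := (\prod_(i | i != j) h i (Z i x))%R.
  have mG : measurable_fun setT G.
    rewrite /G; under eq_fun do rewrite -big_filter.
    by apply: measurable_prod => i _; exact: measurableT_comp.
  pose G' : {mfun S >-> R} := HB.pack G (isMeasurableFun.Build _ _ _ _ G mG).
  have fc0 : (0 <= fine c)%R by exact: fine_ge0.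
  (* The induction hypothesis will identify [nu A] with the integral of [G] over the event that
     [Z j] lies in [A]. *)
  pose nu := mscale (NngNum fc0) (distribution P (Z j)).
  have E x : ((\prod_i h i (Z i x))%:E = (h j (Z j x))%:E * (G' x)%:E :> \bar R).
    by rewrite (bigD1 j)//= EFinM.
  under eq_integral do rewrite E.
  rewrite (@integral_density _ _ _ _ _ P nu (Z j) G' _ _ (EFin \o h j))//=.
  - rewrite ge0_integral_mscale//=.
      rewrite fineK// muleC (bigD1 j)//=; congr (_ * _).
      rewrite ge0_integral_pushforward//; first exact/measurable_EFinP.
      by move=> y _; rewrite lee_fin.
    exact/measurable_EFinP.
    by move=> y _; rewrite lee_fin.
  - by move=> x; apply: prodr_ge0.
  - move=> A mA.
    have mi : measurable_fun setT (\1_A : T -> R) by exact: measurable_indic.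
    pose g : {mfun T >-> R} := HB.pack (\1_A : T -> R) (isMeasurableFun.Build _ _ _ _ _ mi).
    (* With the indicator of [A] in place of [h j], only the indices in [s] are arbitrary, so the
       induction hypothesis applies. *)
    pose h' i := if i == j then g else h i.
    have gP : \int[P]_x (g (Z j x))%:E = P (Z j @^-1` A).
      rewrite -[X in P X]setIT -integral_indic//.
      rewrite -[X in measurable X]setTI.
      exact: (measurable_funP (Z j)).
    have h'j : h' j = g by rewrite /h' eqxx.
    have h'i i : i != j -> h' i = h i by rewrite /h' => /negbTE ->.
    have := IH h'.
    rewrite (bigD1 j)//= h'j gP.
    have -> : \prod_(i | i != j) \int[P]_x (h' i (Z i x))%:E = c.
      by apply: eq_bigr => i ij; rewrite h'i.
    rewrite /nu /mscale/= fineK// /distribution/= /pushforward muleC => <-.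
    + rewrite integral_mkcond; apply: eq_integral => x _.
      rewrite epatch_indic (bigD1 j)//= h'j EFinM muleC /=.
      congr (_ * _%:E); rewrite /G; apply: eq_bigr => i ij.
      by rewrite h'i.
    + by move=> i y; rewrite /h'; case: ifP => // _ /=; rewrite indicE.
    + move=> i; rewrite /h'; case: eqP => [->|//].
      by rewrite gP fin_num_measure// -[X in measurable X]setTI;
         exact: (measurable_funP (Z j)).
    + move=> i si; rewrite /h'; case: eqP => [_|/eqP ij]; first by exists A.
      by apply: hA; rewrite inE negb_or ij.
  - exact/measurable_EFinP.
  - by move=> y; rewrite lee_fin.
by apply: (Hind (enum I)) => // i; rewrite mem_enum.
Qed.

Section average_integral.
Context d (T : measurableType d) (R : realType) (N : nat) (hN : (0 < N)%N).
Variable Q : 'I_N -> probability T R.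

Lemma integral_average (f : T -> \bar R) : measurable_fun setT f ->
  (forall y, 0 <= f y) ->
  \int[average hN Q]_y f y = (N%:R^-1)%:E * \sum_(k < N) \int[Q k]_y f y.
Proof.
move=> mf f0.
have N0 : (0 <= N%:R^-1 :> R)%R by [].
(* [msum] takes a sequence of measures, so the family is continued by zero past [N]. *)
pose m (n : nat) : {measure set T -> \bar R} :=
  if insub n is Some k then Q k else mzero.
rewrite (eq_measure_integral (mscale (NngNum N0) (msum m N))); last first.
  move=> A mA _; rewrite /= /average /mscale/= /msum; congr (_ * _).
  by apply: eq_bigr => k _; rewrite /m valK.
rewrite ge0_integral_mscale//; congr (_ * _).
rewrite ge0_integral_measure_sum//; apply: eq_bigr => k _.
by rewrite /m valK.
Qed.

End average_integral.

(** * Sub-Gaussian variables: second moment and limits *)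

Section sub_gaussian_theory.
Context d (T : measurableType d) (R : realType) (P : probability T R).

Lemma mmt_gen_funE (W : T -> R) t :
  'M_P W t = \int[P]_x (expR (t * W x))%:E.
Proof.
rewrite /mmt_gen_fun unlock; apply: eq_integral => x _ /=.
by rewrite mulrC.
Qed.

Lemma sub_gaussianN (W : T -> R) (sigma : R) :
  sub_gaussian P W sigma -> sub_gaussian P (fun z => - W z)%R sigma.
Proof.
move=> [s0 h]; split=> // t.
have := h (- t)%R; rewrite sqrrN; apply: le_trans.
rewrite !mmt_gen_funE; under eq_integral do rewrite mulrN -mulNr.
by [].
Qed.

Lemma sub_gaussian_le (W : T -> R) (s s' : R) : (s <= s')%R ->
  sub_gaussian P W s -> sub_gaussian P W s'.
Proof.
move=> ss' [s0 h]; split; first exact: le_trans ss'.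
move=> t; apply: (le_trans (h t)); rewrite lee_fin ler_expR.
rewrite ler_pM2r ?invr_gt0// ler_wpM2l ?sqr_ge0//.
by rewrite ler_sqr ?nnegrE// (le_trans s0).
Qed.

(** Everything comes from [1 + y <= expR y]: squared at [y = x / 2] and [y = - x / 2] when
    [0 <= x <= 2], and raised to the fourth power at [y = x / 4] for larger [x], where the cubic
    term makes up the missing quadratic part. *)
Lemma expRD_expRN_ge (x : R) : (2 + x ^+ 2 / 2 <= expR x + expR (- x))%R.
Proof.
wlog x0 : x / (0 <= x)%R => [h|].
  have [/h//|/ltW] := leP 0%R x; rewrite -oppr_ge0 => /h.
  by rewrite sqrrN opprK [X in (_ <= X)%R]addrC.
have sq (n : nat) (y z : R) : (0 <= 1 + y)%R -> (n%:R * y = z)%R ->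
    ((1 + y) ^+ n <= expR z)%R.
  move=> y0 <-; rewrite expRM_natl lerXn2r ?nnegrE ?expR_ge0//.
  exact: expR_ge1Dx.
have [x2|x2] := leP x 2%R.
  have h1 := @sq 2%N (x / 2)%R x ltac:(lra) ltac:(lra).
  have h2 := @sq 2%N (- x / 2)%R (- x)%R ltac:(lra) ltac:(lra).
  by nra.
have h1 := @sq 4%N (x / 4)%R x ltac:(lra) ltac:(lra).
have h2 := expR_ge0 (- x).
have h3 : ((1 + x / 4) ^+ 4 = 1 + x + x ^+ 2 * 3 / 8 + x ^+ 3 / 16 + x ^+ 4 / 256)%R by field.
have h4 : (x ^+ 2 * 2 <= x ^+ 3)%R by rewrite (exprSr x 2) ler_wpM2l ?sqr_ge0// ltW.
have h5 : (0 <= x ^+ 4)%R by exact: exprn_ge0.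
by lra.
Qed.

(** Add the moment bounds at [t = 1 / sigma] and [t = - 1 / sigma]: each is at most
    [expR (1 / 2) <= 2], while the two exponentials add up to at least
    [2 + W ^ 2 / (2 sigma ^ 2)]. *)
Lemma sub_gaussian_sqr (W : {mfun T >-> R}) (sigma : R) : (0 < sigma)%R ->
  sub_gaussian P W sigma ->
  \int[P]_x ((W x) ^+ 2)%:E <= (4 * sigma ^+ 2)%:E.
Proof.
move=> s0 [_ h].
have u0 : (0 < sigma^-1 ^+ 2 / 2 :> R)%R by rewrite divr_gt0// exprn_gt0// invr_gt0.
have e2 : (expR 2^-1 <= 2 :> R)%R.
  have := expR_ge1Dx (- 2^-1 : R); rewrite expRN.
  have := expR_gt0 (2^-1 : R); move: (expR _) => e e0.
  rewrite (_ : 1 + - 2^-1 = 2^-1 :> R)%R; last by lra.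
  by rewrite lef_pV2 ?posrE.
have hb t : (t ^+ 2 = sigma^-1 ^+ 2)%R ->
    \int[P]_x (expR (t * W x))%:E <= 2%:E.
  move=> tE; rewrite -mmt_gen_funE; apply: (le_trans (h t)).
  rewrite lee_fin tE (_ : _ / 2 = 2^-1)%R//.
  by field; exact: lt0r_neq0.
have me t : measurable_fun setT (fun x => (expR (t * W x))%:E : \bar R).
  apply/measurable_EFinP; apply: measurableT_comp => //.
  exact: measurable_funM.
have mW2 : measurable_fun setT (fun x => ((W x) ^+ 2)%:E : \bar R).
  by apply/measurable_EFinP; exact: measurable_funX.
have : 2%:E + (sigma^-1 ^+ 2 / 2)%:E * \int[P]_x ((W x) ^+ 2)%:E <= 2%:E + 2%:E.
  apply: le_trans (leeD (hb sigma^-1 erefl) (hb (- sigma^-1) (sqrrN _)))%R.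
  rewrite -ge0_integralD//=.
  rewrite -ge0_integralZl_EFin//; last 2 first.
  - by move=> x _; rewrite lee_fin sqr_ge0.
  - exact: ltW.
  have -> : 2%:E = \int[P]_x (2%:E : \bar R).
    by rewrite integral_cst//= probability_setT mule1.
  rewrite -ge0_integralD//=; last 2 first.
  - by move=> x _; rewrite mule_ge0// lee_fin ?sqr_ge0// ltW.
  - exact: measurable_funeM.
  apply: ge0_le_integral => //=.
  - by move=> x _; rewrite adde_ge0// mule_ge0// lee_fin ?sqr_ge0// ltW.
  - by apply: emeasurable_funD => //; exact: measurable_funeM.
  - exact: emeasurable_funD.
  - move=> x _; rewrite lee_fin mulNr.
    apply: le_trans (expRD_expRN_ge _); rewrite exprMn.
    by rewrite mulrAC.
rewrite leeD2lE// -lee_pdivlMl// -EFinM => /le_trans; apply.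
rewrite lee_fin le_eqVlt; apply/orP; left; apply/eqP; field.
exact: lt0r_neq0.
Qed.

(** Fatou's lemma for the exponentials. It serves to pass from the density truncated at a score
    level to the density itself. *)
Lemma sub_gaussian_cvg (W_ : {mfun T >-> R}^nat) (W : T -> R) (sigma : R) :
  (forall x, W_ n x @[n --> \oo] --> W x) ->
  (forall n, sub_gaussian P (W_ n) sigma) -> sub_gaussian P W sigma.
Proof.
move=> Wcvg h; split=> [|t]; first by case: (h 0%N).
rewrite mmt_gen_funE.
have m_ n : measurable_fun setT (fun x => (expR (t * W_ n x))%:E : \bar R).
  apply/measurable_EFinP; apply: measurableT_comp => //.
  exact: measurable_funM.
rewrite (_ : \int[P]_x (expR (t * W x))%:E =
    \int[P]_x limn_einf (fun n => (expR (t * W_ n x))%:E)); last first.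
  apply: eq_integral => x _; apply/esym.
  have hc : (expR (t * W_ n x))%:E @[n --> \oo] --> (expR (t * W x))%:E.
    apply: cvg_EFin; first by near=> n.
    apply: (@continuous_cvg _ _ _ _ _ _ expR); first exact: continuous_expR.
    exact: cvgMl_tmp.
  by rewrite (cvg_limn_einf_sup hc).
have e0 n x : [set: T] x -> 0 <= (expR (t * W_ n x))%:E.
  by move=> _; rewrite lee_fin expR_ge0.
apply: (le_trans (fatou P measurableT m_ e0)).
apply: (le_trans (limn_einf_sup _)).
rewrite limn_esup_lim; apply: lime_le => //; first exact: is_cvg_esups.
near=> n; apply: ge_ereal_sup => _ [m /= nm <-].
by rewrite -mmt_gen_funE; case: (h m) => _; apply.
Unshelve. all: by end_near. Qed.

End sub_gaussian_theory.

(** * Chernoff bound for independent points with different laws *)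

Section concentration.
Context d d' (S : measurableType d) (T : measurableType d') (R : realType)
  (P : probability S R) (N : nat) (hN : (0 < N)%N).
Variables (Z : 'I_N.+1 -> {mfun S >-> T}) (Q : 'I_N.+1 -> probability T R).
Hypothesis indep : mutually_independent P (fun k => Z k : S -> T).
Hypothesis Z_law : forall k A, measurable A ->
  distribution P (Z k) A = Q k A.

Lemma integral_law k (f : T -> \bar R) : measurable_fun setT f ->
  (forall y, 0 <= f y) -> \int[P]_w f (Z k w) = \int[Q k]_y f y.
Proof.
move=> mf f0; transitivity (\int[distribution P (Z k)]_y f y); last first.
  by apply: eq_measure_integral => A mA _; exact: Z_law.
by rewrite /distribution ge0_integral_pushforward.
Qed.

(* By AM-GM, the product of the moment generating functions under the [Q k] is
   at most the [N]-th power of the one under their average. *)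
Lemma mmt_gen_fun_sum (g : {mfun T >-> R}) (sigma t : R) :
  sub_gaussian (average hN (calibration Q)) g sigma ->
  \int[P]_w (expR (t * \sum_(k < N) g (calibration Z k w)))%:E <=
    (expR (N%:R * (t ^+ 2 * sigma ^+ 2 / 2)))%:E.
Proof.
move=> [_ /(_ t)]; rewrite mmt_gen_funE => hg.
have me : measurable_fun setT (fun y => expR (t * g y) : R).
  by apply: measurableT_comp => //; exact: measurable_funM.
pose e : {mfun T >-> R} := HB.pack (fun y => expR (t * g y))
  (isMeasurableFun.Build _ _ _ _ _ me).
have mE : measurable_fun setT (fun y => (e y)%:E) by exact/measurable_EFinP.
have e0 y : 0 <= (e y)%:E by rewrite lee_fin expR_ge0.
(* The factor at the test index is constantly 1, so independence of all [N.+1] points yields the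
   product over the calibration points. *)
pose c1 : {mfun T >-> R} := cst 1%R.
pose f (k : 'I_N.+1) := if k == ord_max then c1 else e.
have fmax w : f ord_max w = 1%R by rewrite /f eqxx.
have fwid (k : 'I_N) : f (widen_ord (leqnSn N) k) = e.
  by rewrite /f -val_eqE/= ltn_eqF.
rewrite integral_average// in hg.
have Nr0 : (0 < N%:R :> R)%R by rewrite ltr0n.
have sumle : \sum_(k < N) \int[calibration Q k]_y (e y)%:E <=
    (N%:R * expR (t ^+ 2 * sigma ^+ 2 / 2))%:E.
  by rewrite EFinM -lee_pdivrMl.
have intfin k : \int[calibration Q k]_y (e y)%:E \is a fin_num.
  rewrite ge0_fin_numE ?integral_ge0//; apply: le_lt_trans (ltry _).
  apply: le_trans sumle; rewrite (bigD1 k)//= leeDl// sume_ge0// => i _.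
  exact: integral_ge0.
pose a k := fine (\int[calibration Q k]_y (e y)%:E).
have aE k : \int[calibration Q k]_y (e y)%:E = (a k)%:E by rewrite fineK.
have a0 k : (0 <= a k)%R by rewrite fine_ge0// integral_ge0.
have E w : (expR (t * \sum_(k < N) g (calibration Z k w)))%:E =
    (\prod_i f i (Z i w))%:E.
  rewrite big_ord_recr/= fmax mulr1 mulr_sumr expR_sum; congr _%:E.
  by apply: eq_bigr => k _; rewrite fwid.
under eq_integral do rewrite E.
have intE (k : 'I_N) : \int[P]_x (f (widen_ord (leqnSn N) k)
    (Z (widen_ord (leqnSn N) k) x))%:E = (a k)%:E.
  by rewrite fwid -aE; exact: (integral_law _ mE e0).
have int1 : \int[P]_x (f ord_max (Z ord_max x))%:E = 1.
  under eq_integral do rewrite fmax.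
  by rewrite integral_cst//= probability_setT mule1.
rewrite mutually_independent_integral_prod//; last 2 first.
- by move=> i y; rewrite /f; case: ifP => //= _; exact: expR_ge0.
- move=> i; have [->|im] := eqVneq i ord_max; first by rewrite int1.
  have iN : (i < N)%N by rewrite ltn_neqAle -ltnS ltn_ord andbT.
  rewrite (_ : i = widen_ord (leqnSn N) (Ordinal iN)); last exact: val_inj.
  by rewrite intE.
rewrite big_ord_recr/= int1 mule1.
under eq_bigr do rewrite intE.
rewrite prodEFin lee_fin expRM_natl.
have sumle' : (\sum_(k < N) a k <= N%:R * expR (t ^+ 2 * sigma ^+ 2 / 2))%R.
  by rewrite -lee_fin -sumEFin; under eq_bigr do rewrite -aE.
have := @leif_AGM R 'I_N xpredT a (fun i _ => a0 i).
move=> /leif_le; rewrite card_ord => /le_trans; apply.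
rewrite lerXn2r ?nnegrE ?expR_ge0//.
  by rewrite divr_ge0// sumr_ge0.
by rewrite ler_pdivrMr// mulrC.
Qed.

(** Chernoff's bound at [r = delta / sigma ^ 2], which minimizes the exponent
    [N (r ^ 2 sigma ^ 2 / 2 - r delta)]. *)
Lemma sub_gaussian_tail (g : {mfun T >-> R}) (sigma delta : R) : (0 < sigma)%R ->
  (0 < delta)%R -> sub_gaussian (average hN (calibration Q)) g sigma ->
  P [set w | (N%:R * delta <= \sum_(k < N) g (calibration Z k w))%R] <=
    (expR (- (N%:R * delta ^+ 2 / (2 * sigma ^+ 2))))%:E.
Proof.
move=> s0 d0 hg.
have mX : measurable_fun setT
    (fun w => \sum_(k < N) g (calibration Z k w) : R)%R.
  by apply: measurable_sum => k; exact: measurableT_comp.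
pose X : {mfun S >-> R} := HB.pack (fun w => \sum_(k < N) g (calibration Z k w) : R)%R
  (isMeasurableFun.Build _ _ _ _ _ mX).
have r0 : (0 < delta / sigma ^+ 2)%R by rewrite divr_gt0// exprn_gt0.
apply: (le_trans (chernoff (P := P) X (N%:R * delta) r0)).
rewrite mmt_gen_funE.
have := mmt_gen_fun_sum (delta / sigma ^+ 2) hg.
rewrite -(@lee_pmul2r _ (expR (- (delta / sigma ^+ 2 * (N%:R * delta))))%:E)//; last first.
  by rewrite lte_fin expR_gt0.
move=> /le_trans; apply; rewrite -EFinM -expRD lee_fin ler_expR le_eqVlt.
apply/orP; left; apply/eqP; field.
exact: lt0r_neq0.
Qed.

End concentration.

(** * Non-coverage as an inequality between weighted sums *)

Section confidence_set_complement.
Context (R : realType) (X Y : Type) (N : nat).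
Variables (V lambda : X * Y -> R) (D : 'I_N -> X * Y).
Hypothesis lambda_ge0 : forall z, (0 <= lambda z)%R.

Lemma weighted_score_law_itv z (v : R) :
  weighted_score_law V lambda D z [set u : \bar R | -oo < u <= v%:E] =
  ((\sum_(k < N) lambda (D k) * (V (D k) <= v)%R%:R) /
   (lambda z + \sum_(l < N) lambda (D l)))%:E.
Proof.
rewrite /weighted_score_law diracE memNset ?mule0 ?adde0; last first.
  by move=> /=; rewrite leNgt ltry.
rewrite mulr_suml -sumEFin; apply: eq_bigr => k _.
rewrite diracE -EFinM /weight mulrAC; congr (_ * (nat_of_bool _)%:R / _)%:E.
by apply/idP/idP; rewrite inE/= ltNyr lee_fin.
Qed.

(** The quantile is below the score iff some real level below the score already carries mass
    [1 - alpha]. Only finitely many scores occur, so that level can be pushed up to just under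
    [V (x, y)], which gives the strict comparison. If the total weight is zero, all weights vanish,
    the quantile is [+oo] and the point is covered; hence the positivity clause. *)
Lemma not_confidence_set (alpha : R) x y : (alpha < 1)%R ->
  ~ confidence_set V lambda D alpha x y <->
  (0 < lambda (x, y) + \sum_(l < N) lambda (D l))%R /\
  ((1 - alpha) * (lambda (x, y) + \sum_(l < N) lambda (D l)) <=
   \sum_(k < N) lambda (D k) * (V (D k) < V (x, y))%R%:R)%R.
Proof.
move=> alpha1; set S := (lambda (x, y) + _)%R.
have S0 : (0 <= S)%R by rewrite addr_ge0// sumr_ge0.
have beta0 : (0 < 1 - alpha)%R by rewrite subr_gt0.
rewrite /confidence_set /=; split => [/negP|[Spos h]]; last first.
  apply/negP; rewrite -ltNge.
  (* The default value [V (x, y) - 1] keeps [v] strictly below [V (x, y)] in every case. *)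
  pose v := (\big[Num.max/V (x, y) - 1]_(k < N | V (D k) < V (x, y)) V (D k))%R.
  have vV : (v < V (x, y))%R by apply/bigmax_ltP; split => //; rewrite gtrBl.
  apply: (@le_lt_trans _ _ v%:E); last by rewrite lte_fin.
  apply: ereal_inf_lbound; exists v => //=.
  rewrite weighted_score_law_itv lee_fin ler_pdivlMr//; apply: (le_trans h).
  apply: ler_sum => k _; rewrite ler_wpM2l// ler_nat.
  case: (ltP (V (D k))) => //= hk; rewrite lt0b.
  exact: (le_bigmax_cond _ (fun k => V (D k)) hk).
rewrite -ltNge => /ereal_inf_lt[_ [v hv <-]]; rewrite lte_fin => vV.
move: hv; rewrite /= weighted_score_law_itv lee_fin => hv.
(* Division by zero gives zero, so a zero total weight would leave mass zero, less than
   [1 - alpha]. *)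
have Spos : (0 < S)%R.
  rewrite lt_neqAle S0 andbT eq_sym; apply/eqP => S00.
  by move: hv; rewrite -/S S00 invr0 mulr0 leNgt beta0.
split => //; move: hv; rewrite ler_pdivlMr// => /le_trans; apply.
apply: ler_sum => k _; rewrite ler_wpM2l// ler_nat.
by case: (leP (V (D k))) => //= hk; rewrite lt0b (le_lt_trans hk).
Qed.

End confidence_set_complement.

(** * Quantile levels of an atomless law *)

Section atomless.
Context d (T : measurableType d) (R : realType) (P : probability T R).

(** The level is the supremum of the [v] with [cdf X v < s]. Right continuity of the cdf gives mass
    at least [s] there, left continuity of the mass of open half-lines gives at most [s], and
    without atoms the two masses agree. *)
Lemma exists_quantile (X : {RV P >-> R}) (s : R) : (0 < s < 1)%R ->
  (forall v, P [set x | X x = v] = 0) ->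
  exists v, P [set x | (X x < v)%R] = s%:E.
Proof.
move=> /andP[s0 s1] atomless.
pose A := [set v : R | cdf X v < s%:E].
have Ane : A !=set0.
  have /(_ [set u | u < s%:E]) := cvg_cdfNy0 X.
  have : nbhs (0 : \bar R) [set u | u < s%:E] by exact: lt_nbhsl.
  move=> /[swap] /[apply] -[M [_ hM]]; exists (M - 1)%R; apply: hM.
  by rewrite gtrBl.
have [M hM] : exists M, forall v, (M < v)%R -> s%:E < cdf X v.
  have /(_ [set u | s%:E < u]) := cvg_cdfy1 X.
  have : nbhs (1 : \bar R) [set u | s%:E < u] by exact: lt_nbhsr.
  by move=> /[swap] /[apply] -[M [_ h]]; exists M.
have Aub : has_ubound A.
  exists M => v /= Av; rewrite leNgt; apply/negP => /hM.
  by move=> /lt_trans/(_ Av); rewrite ltxx.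
have hA : has_sup A by [].
pose v0 := sup A; exists v0.
have mlt v : measurable [set x | (X x < v)%R].
  have := measurable_funPTI X (measurable_itv `]-oo, v[).
  by congr (measurable _); apply/seteqP; split => x /=; rewrite in_itv.
have meq v : measurable [set x | X x = v].
  exact: (measurable_funPTI X (measurable_set1 v)).
have cdfE v : cdf X v = P [set x | (X x < v)%R].
  rewrite /cdf /distribution /= /pushforward.
  rewrite (_ : X @^-1` _ = [set x | (X x < v)%R] `|` [set x | X x = v]).
    rewrite measureU//.
      by rewrite [X in _ + X](atomless v) adde0.
    by apply/seteqP; split => x //= -[h1 h2]; move: h1; rewrite h2 ltxx.
  apply/seteqP; split => x /=; rewrite in_itv/= le_eqVlt.
    by move=> /orP[/eqP|]; [right|left].
  by move=> [->|->]; rewrite ?orbT ?eqxx.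
apply/eqP; rewrite eq_le; apply/andP; split; last first.
  rewrite -cdfE leNgt; apply/negP => hlt.
  have := @cdf_right_continuous _ _ _ _ X v0.
  have hn : nbhs (cdf X v0 : \bar R) [set u : \bar R | u < s%:E].
    by apply: open_nbhs_nbhs; split => //; exact: open_ereal_lt_ereal.
  move=> /(_ _ hn) [e/= e0 he].
  have /= h := he (v0 + e / 2)%R.
  have : A (v0 + e / 2)%R.
    apply: h; last by rewrite ltrDl divr_gt0.
    rewrite opprD addrA subrr add0r normrN gtr0_norm ?divr_gt0//.
    by rewrite ltr_pdivrMr// ltr_pMr// ltr1n.
  move=> /(sup_upper_bound hA); rewrite -/v0 leNgt ltrDl divr_gt0//.
pose F n := [set x | (X x < v0 - n.+1%:R^-1)%R].
have bF : \bigcup_n F n = [set x | (X x < v0)%R].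
  apply/seteqP; split => x /=.
    by move=> [n _ /= /lt_trans]; apply; rewrite gtrBl.
  move=> xv; have d0 : (0 < v0 - X x)%R by rewrite subr_gt0.
  exists (Num.truncn (v0 - X x)^-1) => //=; rewrite /F/=.
  rewrite ltrBrDr -ltrBrDl invf_plt ?posrE//.
  exact: Num.Theory.truncnS_gt.
have : P (F n) @[n --> \oo] --> P (\bigcup_n F n).
  apply: nondecreasing_cvg_mu; [by move=> n; exact: mlt|by rewrite bF|].
  move=> m n mn; apply/subsetPset => x /= /lt_le_trans; apply.
  by rewrite lerD2l lerN2 lef_pV2 ?posrE// ler_nat.
rewrite bF => /cvg_lim <- //; apply: lime_le.
  apply: ereal_nondecreasing_is_cvgn => m n mn; apply: le_measure; [by rewrite inE; exact: mlt..|].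
  move=> x /= /lt_le_trans; apply.
  by rewrite lerD2l lerN2 lef_pV2 ?posrE// ler_nat.
near=> n.
have n0 : (0 < n.+1%:R^-1 :> R)%R by rewrite invr_gt0.
have [a Aa ha] := sup_adherent n0 hA.
apply: (le_trans _ (ltW Aa)); rewrite cdfE; apply: le_measure; [by rewrite inE; exact: mlt..|].
by move=> x /= /lt_trans; apply.
Unshelve. all: by end_near. Qed.

End atomless.

(** * Second moment and tail of a density *)

Section density.
Context d (T : measurableType d) (R : realType).
Variables (mu nu : probability T R) (lambda : {mfun T >-> R}).
Hypothesis lambda_ge0 : forall z, (0 <= lambda z)%R.
Hypothesis lambda_density : forall A, measurable A ->
  \int[mu]_(x in A) (lambda x)%:E = nu A.

Lemma integral_densityT : \int[mu]_x (lambda x)%:E = 1.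
Proof. by rewrite lambda_density// probability_setT. Qed.

(* [x ^ 3 + 2 - 3 x = (x - 1) ^ 2 (x + 2)] *)
Lemma density_second_moment_ge1 : 1 <= \int[nu]_x ((lambda x) ^+ 2)%:E.
Proof.
have m2 : measurable_fun setT (fun x => ((lambda x) ^+ 2)%:E : \bar R).
  by apply/measurable_EFinP; exact: measurable_funX.
have ml : measurable_fun setT (fun x => (lambda x)%:E : \bar R).
  exact/measurable_EFinP.
(* The change of variables along the identity turns the second moment under [nu] into the third
   moment under [mu]. *)
pose i : {mfun T >-> T} := HB.pack (fun x : T => x)
  (isMeasurableFun.Build _ _ _ _ _ (@measurable_id _ T setT)).
rewrite -(@integral_density _ _ _ _ _ mu nu i lambda lambda_ge0 _ _ m2)//; last first.
  by move=> y; rewrite lee_fin sqr_ge0.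
have m3 : measurable_fun setT
    (fun x => ((lambda x) ^+ 2)%:E * (lambda x)%:E : \bar R).
  exact: emeasurable_funM.
have p3 x : 0 <= ((lambda x) ^+ 2)%:E * (lambda x)%:E.
  by rewrite mule_ge0// lee_fin ?sqr_ge0.
rewrite -(@leeD2lE _ 2%:E)//.
have -> : 2%:E + 1 = \int[mu]_x (3%:E * (lambda x)%:E).
  rewrite ge0_integralZl_EFin//=; last by move=> x _; rewrite lee_fin.
  by rewrite integral_densityT mule1 -EFinD; congr _%:E; lra.
rewrite [X in X + _](_ : 2%:E = \int[mu]_x (cst 2%:E x)); last first.
  by rewrite integral_cst//= probability_setT mule1.
rewrite -ge0_integralD//=.
apply: ge0_le_integral => //=.
- by move=> x _; rewrite mule_ge0// lee_fin.
- exact: measurable_funeM.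
- exact: emeasurable_funD.
- move=> x _; rewrite -!EFinM -EFinD lee_fin.
  have := lambda_ge0 x; have := sqr_ge0 (lambda x - 1); nra.
Qed.

(** [nu] has density [lambda], and [lambda <= (2 / r) (lambda - 1) ^ 2] wherever [lambda > 2 + r];
    the second moment of [lambda - 1] is at most [4 sigma ^ 2]. *)
Lemma density_tail (sigma r : R) : (0 < sigma)%R -> (0 < r)%R ->
  sub_gaussian mu (fun z => lambda z - 1)%R sigma ->
  nu [set z | (2 + r < lambda z)%R] <= (8 * sigma ^+ 2 / r)%:E.
Proof.
move=> s0 r0 hs.
have mg : measurable_fun setT (fun z => lambda z - 1 : R)%R.
  exact: measurable_funB.
pose g : {mfun T >-> R} := HB.pack (fun z => lambda z - 1 : R)%R
  (isMeasurableFun.Build _ _ _ _ _ mg).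
have mB : measurable [set z | (2 + r < lambda z)%R].
  have := measurable_funPTI lambda (measurable_itv `]2 + r, +oo[%R).
  by congr (measurable _); apply/seteqP; split => x /=; rewrite in_itv/= andbT.
have mg2 : measurable_fun setT (fun x => ((g x) ^+ 2)%:E : \bar R).
  by apply/measurable_EFinP; exact: measurable_funX.
have mg2c : measurable_fun setT (fun x => (2 / r)%:E * ((g x) ^+ 2)%:E : \bar R).
  exact: measurable_funeM.
have c0 : (0 <= 2 / r)%R by rewrite divr_ge0// ltW.
have g2 x : 0 <= (2 / r)%:E * ((g x) ^+ 2)%:E.
  by rewrite mule_ge0// lee_fin ?sqr_ge0.
rewrite -lambda_density//.
apply: (@le_trans _ _ (\int[mu]_(x in [set z | (2 + r < lambda z)%R])
    ((2 / r)%:E * ((g x) ^+ 2)%:E))).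
  apply: ge0_le_integral => //=.
  - by move=> x _; rewrite lee_fin.
  - by apply/measurable_EFinP; exact: measurable_funTS.
  - exact: measurable_funTS.
  - move=> x h; rewrite -EFinM lee_fin mulrAC ler_pdivlMr//.
    (* This product is [2 (lambda - 1) ^ 2 - r lambda] minus the positive constant
       [2 + 2 r + r ^ 2]. *)
    have : (0 <= (lambda x - 2 - r) * (2 * lambda x + r))%R by apply: mulr_ge0; lra.
    by rewrite /=; nra.
apply: (@le_trans _ _ (\int[mu]_x ((2 / r)%:E * ((g x) ^+ 2)%:E))).
  by apply: ge0_subset_integral.
rewrite ge0_integralZl_EFin//=; last by move=> x _; rewrite lee_fin sqr_ge0.
apply: (@le_trans _ _ ((2 / r)%:E * (4 * sigma ^+ 2)%:E)).
  by apply: lee_wpmul2l; rewrite ?lee_fin//; exact: (sub_gaussian_sqr (W := g)).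
by rewrite -EFinM lee_fin le_eqVlt; apply/orP; left; apply/eqP; field; exact: lt0r_neq0.
Qed.

End density.

(** * Probabilities of miscoverage and of coverage through one fixed level *)

Section coverage.
Context dO d (Omega : measurableType dO) (T : measurableType d) (R : realType)
  (P : probability Omega R) (N : nat) (hN : (0 < N)%N).
Variables (V lambda : {mfun T >-> R}) (Z : 'I_N.+1 -> {mfun Omega >-> T})
  (Q : 'I_N.+1 -> probability T R) (alpha sigma : R).
Hypothesis Z_indep : mutually_independent P (fun k => Z k : Omega -> T).
Hypothesis Z_law : forall k A, measurable A ->
  distribution P (Z k) A = Q k A.
Hypothesis lambda_ge0 : forall z, (0 <= lambda z)%R.
Local Notation cal := (average hN (calibration Q)).
Hypothesis lambda_density : forall A, measurable A ->
  \int[cal]_(x in A) (lambda x)%:E = Q ord_max A.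
Hypothesis no_ties : {ae P, forall w, forall k : 'I_N,
  V (calibration Z k w) <> V (Z ord_max w)}.
Hypothesis sigma_gt0 : (0 < sigma)%R.
Hypothesis lambda_sub_gaussian : forall v : R,
  sub_gaussian cal (fun z => lambda z * \1_[set z' | (V z' < v)%R] z -
    fine (Q ord_max [set z' | (V z' < v)%R]))%R sigma.

Lemma measurable_score_lt (v : R) : measurable [set z | (V z < v)%R].
Proof.
have := measurable_funPTI V (measurable_itv `]-oo, v[%R).
by congr (measurable _); apply/seteqP; split => x /=; rewrite in_itv.
Qed.

(** A calibration score and the test score both equal to [v] form a tie, so by independence the
    product of their masses at [v] is zero. If the test law had an atom there, every calibration
    law, hence [cal], would give [v] mass zero, and so would the test law, which has a density with
    respect to [cal]. *)
Lemma score_atomless v : Q ord_max [set z | V z = v] = 0.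
Proof.
have mA : measurable [set z | V z = v].
  exact: (measurable_funPTI V (measurable_set1 v)).
have mZA k : measurable (Z k @^-1` [set z | V z = v]).
  exact: measurable_funPTI.
have Q0 k : calibration Q k [set z | V z = v] * Q ord_max [set z | V z = v] = 0.
  pose j := widen_ord (leqnSn N) k.
  have jm : j != ord_max by rewrite -val_eqE/= ltn_eqF.
  have := @Z_indep [set j; ord_max]%SET (fun=> [set z | V z = v]).
  rewrite big_setU1 ?big_set1 ?finset.in_set1//= => /(_ (fun _ _ => mA)).
  rewrite -[X in _ = X * _]/(distribution P (Z j) [set z | V z = v]).
  rewrite -[X in _ = _ * X]/(distribution P (Z ord_max) [set z | V z = v]).
  rewrite !Z_law// => <-.
  case: no_ties => B [mB B0 hB].
  apply/eqP; rewrite eq_le measure_ge0 andbT -B0.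
  apply: le_measure; rewrite ?inE//.
    by apply: fin_bigcap_measurable => //.
  move=> w hw; apply: hB => /= /(_ k); apply.
  have /= -> := hw j; last by rewrite finset.in_setU1 eqxx.
  by have /= -> := hw ord_max; last by rewrite !finset.inE eqxx orbT.
have [//|Qn0] := eqVneq (Q ord_max [set z | V z = v]) 0.
have QA0 k : calibration Q k [set z | V z = v] = 0.
  by have /eqP := Q0 k; rewrite mule_eq0 (negbTE Qn0) orbF => /eqP.
have cal0 : cal [set z | V z = v] = 0.
  by rewrite /= /average big1 ?mule0// => k _; exact: QA0.
rewrite -lambda_density//; apply: null_set_integral => //.
apply/measurable_EFinP; exact: measurable_funTS.
Qed.

(** The subtracted constant is the mean of the first term under [cal], by [lambda_density]. *)
Definition lambda_below (v : R) (z : T) : R :=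
  (lambda z * \1_[set z' | (V z' < v)%R] z - fine (Q ord_max [set z' | (V z' < v)%R]))%R.

Lemma measurable_lambda_below v : measurable_fun setT (lambda_below v).
Proof.
apply: measurable_funB => //; apply: measurable_funM => //.
exact: measurable_indic (measurable_score_lt v).
Qed.

HB.instance Definition _ v :=
  isMeasurableFun.Build _ _ _ _ _ (measurable_lambda_below v).

(** Let the level [v] run through the integers: at each point the indicator is eventually 1, the
    masses increase to 1, and the sub-Gaussian property passes to the limit. *)
Lemma sub_gaussian_density : sub_gaussian cal (fun z => lambda z - 1)%R sigma.
Proof.
apply: (@sub_gaussian_cvg _ _ _ _ (fun n => lambda_below n%:R : {mfun T >-> R})); last first.
  by move=> n; exact: lambda_sub_gaussian.
move=> x; apply: cvgB.
  apply: cvg_near_cst; near=> n.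
  rewrite indicE mem_set ?mulr1//=.
  near: n; exact: nbhs_infty_gtr.
rewrite [X in _ --> X](_ : _ = fine (Q ord_max setT)); last by rewrite probability_setT.
apply: fine_cvg; rewrite fineK ?fin_num_measure//.
have <- : \bigcup_n [set z' | (V z' < n%:R)%R] = setT.
  rewrite -subTset => z _; exists (Num.truncn (V z)).+1 => //=.
  exact: Num.Theory.truncnS_gt.
apply: nondecreasing_cvg_mu.
- by move=> n; exact: measurable_score_lt.
- by apply: bigcup_measurable => n _; exact: measurable_score_lt.
- move=> m n mn; apply/subsetPset => z /= /lt_le_trans; apply.
  by rewrite ler_nat.
Unshelve. all: by end_near. Qed.

Let S w := (lambda (Z ord_max w) + \sum_(k < N) lambda (calibration Z k w))%R.
Let B w := (\sum_(k < N) lambda (calibration Z k w) *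
  (V (calibration Z k w) < V (Z ord_max w))%R%:R)%R.

(** Non-coverage of the test point in the form given by [not_confidence_set], free of quantiles. *)
Definition miscoverage := [set w | (0 < S w)%R /\ ((1 - alpha) * S w <= B w)%R].

Lemma measurable_miscoverage : measurable miscoverage.
Proof.
have mlam k : measurable_fun setT (fun w => lambda (calibration Z k w) : R).
  exact: measurableT_comp.
have mS : measurable_fun setT S.
  apply: measurable_funD; first exact: measurableT_comp.
  exact: measurable_sum.
have mB : measurable_fun setT B.
  apply: measurable_sum => k; apply: measurable_funM => //.
  have mV j : measurable_fun setT (fun w => V (Z j w) : R).
    exact: measurableT_comp.
  have mlt := measurable_fun_ltr (mV (widen_ord (leqnSn N) k)) (mV ord_max).
  rewrite (_ : (fun w => _) =
      (fun b : bool => b%:R : R)%R \o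
      (fun w => V (calibration Z k w) < V (Z ord_max w))%R)//.
  exact: measurableT_comp mlt.
rewrite (_ : miscoverage = [set w | (0 < S w)%R] `&`
  [set w | (0 <= B w - (1 - alpha) * S w)%R]); last first.
  by apply/seteqP; split => w /=; rewrite subr_ge0.
apply: measurableI.
  have := mS measurableT _ (measurable_itv `]0%R, +oo[%R).
  rewrite setTI; congr (measurable _); apply/seteqP; split => x /=; by rewrite in_itv/= andbT.
have mD : measurable_fun setT (fun w => B w - (1 - alpha) * S w)%R.
  by apply: measurable_funB => //; exact: measurable_funM.
have := mD measurableT _ (measurable_itv `[0%R, +oo[%R).
by rewrite setTI; congr (measurable _); apply/seteqP; split => x /=; rewrite in_itv/= andbT.
Qed.

Lemma law_set A : measurable A -> P (Z ord_max @^-1` A) = Q ord_max A.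
Proof. exact: Z_law. Qed.

Hypotheses (alpha_gt0 : (0 < alpha)%R) (alpha_lt1 : (alpha < 1)%R).
Variable delta : R.
Hypothesis delta_gt0 : (0 < delta)%R.
Local Notation eps := (expR (- (N%:R * delta ^+ 2 / (2 * sigma ^+ 2)))).

Let Nr0 : (0 < N%:R :> R)%R. Proof. by rewrite ltr0n. Qed.

Let dev (g : T -> R) :=
  [set w | (N%:R * delta <= \sum_(k < N) g (calibration Z k w))%R].

Let measurable_dev (g : {mfun T >-> R}) : measurable (dev g).
Proof.
have mX : measurable_fun setT
    (fun w => \sum_(k < N) g (calibration Z k w) : R)%R.
  by apply: measurable_sum => k; exact: measurableT_comp.
have := mX measurableT _ (measurable_itv `[(N%:R * delta)%R, +oo[%R).
by rewrite setTI; congr (measurable _); apply/seteqP; split => x /=; rewrite in_itv/= andbT.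
Qed.

Let dev_le (g : {mfun T >-> R}) : sub_gaussian cal g sigma ->
  P (dev g) <= eps%:E.
Proof. exact: sub_gaussian_tail. Qed.

Let mlamB1 : measurable_fun setT (fun z => lambda z - 1 : R)%R.
Proof. exact: measurable_funB. Qed.
Let lamB1 : {mfun T >-> R} := HB.pack (fun z => lambda z - 1 : R)%R
  (isMeasurableFun.Build _ _ _ _ _ mlamB1).
Let mfunN (g : {mfun T >-> R}) : {mfun T >-> R} := HB.pack (fun z => - g z : R)%R
  (isMeasurableFun.Build _ _ _ _ _ (measurable_funN (measurable_funPT g))).

Let sum_below v w : (\sum_(k < N) lambda_below v (calibration Z k w) =
  \sum_(k < N) lambda (calibration Z k w) * (V (calibration Z k w) < v)%R%:R -
  N%:R * fine (Q ord_max [set z' | (V z' < v)%R]))%R.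
Proof.
rewrite sumrB sumr_const card_ord mulr_natl; congr (_ - _)%R.
by apply: eq_bigr => k _; rewrite indicE mem_setE.
Qed.

Let sumB1 w : (\sum_(k < N) (lambda (calibration Z k w) - 1) =
  \sum_(k < N) lambda (calibration Z k w) - N%:R)%R.
Proof. by rewrite sumrB sumr_const card_ord. Qed.

(** Fix [v] where the test score law has mass [s = 1 - alpha - 2 delta]. Miscoverage forces a score
    at least [v], of probability [alpha + 2 delta], or one of two deviations by [N delta], each of
    probability at most [eps]. *)
Lemma miscoverage_le : P miscoverage <= (alpha + 2 * delta + 2 * eps)%:E.
Proof.
have [a_gt0 a_lt1 d_gt0 n_gt0] : [/\ (0 < alpha :> R)%R, (alpha < 1 :> R)%R,
  (0 < delta :> R)%R & (0 < N%:R :> R)%R] by [].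
have eps0 := expR_gt0 (- (N%:R * delta ^+ 2 / (2 * sigma ^+ 2))).
pose s : R := (1 - alpha - 2 * delta)%R.
have [sle|s0] := leP s 0%R.
  apply: le_trans (probability_le1 P measurable_miscoverage) _.
  rewrite lee_fin; move: sle; rewrite /s; lra.
have s01 : (0 < s < 1)%R by rewrite s0 /= /s; lra.
have [v hv] := @exists_quantile _ _ _ (Q ord_max) V s s01 score_atomless.
pose D1 := dev (lambda_below v); pose D2 := dev (mfunN lamB1).
pose D0 := ~` (Z ord_max @^-1` [set z | (V z < v)%R]).
have mD0 : measurable D0.
  by apply: measurableC; apply: measurable_funPTI; exact: measurable_score_lt.
have PD0 : P D0 = (1 - s)%:E.
  rewrite probability_setC; last by apply: measurable_funPTI; exact: measurable_score_lt.
  by rewrite law_set ?hv//; exact: measurable_score_lt.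
have mD1 : measurable D1 by exact: measurable_dev.
have mD2 : measurable D2 by exact: measurable_dev.
have sub : miscoverage `<=` D0 `|` D1 `|` D2.
  move=> w [S0 SB].
  have [Vv|vV] := ltP (V (Z ord_max w)) v; last first.
    by left; left; rewrite /D0 /= => /(le_lt_trans vV); rewrite ltxx.
  have [h1|h1] := leP (N%:R * delta)%R (\sum_(k < N) lambda_below v (calibration Z k w))%R.
    by left; right.
  right; rewrite /D2 /dev /= sumrN sumB1 leNgt; apply/negP => h2.
  move: h1; rewrite sum_below hv /=.
  set A := (\sum_(k < N) _ * _)%R => h1.
  have BA : (B w <= A)%R.
    apply: ler_sum => k _; rewrite ler_wpM2l// ler_nat.
    by case: (ltP (V (calibration Z k w))) => //= hk; rewrite lt0b (lt_trans hk).
  (* Without deviations, [A < N (1 - alpha - delta)] and [L > N (1 - delta)], so [(1 - alpha) L]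
     exceeds [A] by more than [alpha N delta], against [(1 - alpha) (l + L) <= B w <= A]. *)
  move: SB h1 h2; rewrite /S /s; set L := (\sum_(k < N) lambda _)%R.
  have := lambda_ge0 (Z ord_max w); set l := lambda _ => l0 SB h1 h2.
  have a1 : (0 < 1 - alpha)%R by lra.
  have h3 : (0 <= (1 - alpha) * l)%R by rewrite mulr_ge0// ltW.
  have h4 : (0 < (1 - alpha) * (L - N%:R + N%:R * delta))%R by rewrite mulr_gt0//; lra.
  have h5 : (0 < alpha * (N%:R * delta))%R by rewrite !mulr_gt0.
  by nra.
apply: (@le_trans _ _ (P D0 + P D1 + P D2)).
  apply: le_trans (le_measure _ _ _ sub) _; rewrite ?inE//.
  - exact: measurable_miscoverage.
  - by apply: measurableU => //; exact: measurableU.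
  apply: le_trans (measureU2 _ _ _) _ => //; first exact: measurableU.
  by rewrite leeD2r//; exact: measureU2.
have h1 : P D1 <= eps%:E by apply: dev_le; exact: lambda_sub_gaussian.
have h2 : P D2 <= eps%:E.
  by apply: dev_le; apply: sub_gaussianN; exact: sub_gaussian_density.
rewrite PD0; apply: le_trans (leeD (leeD (lexx _) h1) h2) _.
rewrite -!EFinD lee_fin /s; lra.
Qed.

(** The mirror argument at mass [s = 1 - alpha + 2 delta + t]. The weight of the test point enters
    only the total weight and so favours coverage; the event that it exceeds [N t] is kept as the
    last term. *)
Lemma coverage_le (t : R) : (0 < t)%R ->
  P (~` miscoverage) <= (1 - alpha + 2 * delta + t + 2 * eps)%:E +
    Q ord_max [set z | (N%:R * t < lambda z)%R].
Proof.
move=> t0.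
have [a_gt0 a_lt1 d_gt0 n_gt0] : [/\ (0 < alpha :> R)%R, (alpha < 1 :> R)%R,
  (0 < delta :> R)%R & (0 < N%:R :> R)%R] by [].
have eps0 := expR_gt0 (- (N%:R * delta ^+ 2 / (2 * sigma ^+ 2))).
pose s : R := (1 - alpha + 2 * delta + t)%R.
have [sge|s1] := leP 1%R s.
  apply: (@le_trans _ _ 1).
    by apply: probability_le1; exact: measurableC measurable_miscoverage.
  apply: (@le_trans _ _ (1%:E + 0)); first by rewrite adde0.
  apply: leeD => //; rewrite lee_fin; move: sge; rewrite /s; lra.
have s01 : (0 < s < 1)%R by rewrite s1 andbT /s; lra.
have [v hv] := @exists_quantile _ _ _ (Q ord_max) V s s01 score_atomless.
pose D0 := Z ord_max @^-1` [set z | (V z < v)%R].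
pose D1 := dev (mfunN (lambda_below v)); pose D2 := dev lamB1.
pose D3 := Z ord_max @^-1` [set z | (N%:R * t < lambda z)%R].
have mD0 : measurable D0 by apply: measurable_funPTI; exact: measurable_score_lt.
have PD0 : P D0 = s%:E by rewrite law_set ?hv//; exact: measurable_score_lt.
have mt : measurable [set z | (N%:R * t < lambda z)%R].
  have := measurable_funPTI lambda (measurable_itv `]N%:R * t, +oo[%R).
  by congr (measurable _); apply/seteqP; split => x /=; rewrite in_itv/= andbT.
have mD3 : measurable D3 by exact: measurable_funPTI.
have PD3 : P D3 = Q ord_max [set z | (N%:R * t < lambda z)%R] by exact: law_set.
have mD1 : measurable D1 by exact: measurable_dev.
have mD2 : measurable D2 by exact: measurable_dev.
have sub : ~` miscoverage `<=` D0 `|` D1 `|` D2 `|` D3.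
  move=> w nE.
  have [Vv|vV] := ltP (V (Z ord_max w)) v; first by left; left; left.
  have [h3|h3] := ltP (N%:R * t)%R (lambda (Z ord_max w)); first by right.
  have [h2|h2] := leP (N%:R * delta)%R (\sum_(k < N) lamB1 (calibration Z k w))%R.
    by left; right.
  left; left; right; rewrite /D1 /dev /= sumrN leNgt; apply/negP => h1.
  apply: nE; move: h1; rewrite sum_below hv /=.
  set A := (\sum_(k < N) _ * _)%R => h1.
  have AB : (A <= B w)%R.
    apply: ler_sum => k _; rewrite ler_wpM2l// ler_nat.
    by case: (ltP (V (calibration Z k w))) => //= hk; rewrite lt0b (lt_le_trans hk).
  have AL : (A <= \sum_(k < N) lambda (calibration Z k w))%R.
    by apply: ler_sum => k _; rewrite ler_piMr// lern1 leq_b1.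
  move: h2 AL; rewrite /lamB1/= sumB1 /miscoverage /= /S /s.
  move: h1 h3 (lambda_ge0 (Z ord_max w)); rewrite /s.
  set L := (\sum_(k < N) lambda _)%R; set l := lambda _ => h1 h3 l0 h2 AL.
  (* Here [A > N (1 - alpha + delta + t)], [L < N (1 + delta)] and [l <= N t]. Hence
     [(1 - alpha) (l + L)] stays below [A] with room [alpha N (delta + t)], and [L >= A > 0] makes
     the total weight positive. *)
  have a1 : (0 < 1 - alpha)%R by lra.
  have h4 : (0 < N%:R * (1 - alpha + delta + t))%R by rewrite mulr_gt0//; lra.
  split; first by nra.
  have h5 : (0 <= (1 - alpha) * (N%:R * t - l))%R by rewrite mulr_ge0 ?subr_ge0// ltW.
  have h6 : (0 <= (1 - alpha) * (N%:R * delta + N%:R - L))%R by rewrite mulr_ge0//; lra.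
  have h7 : (0 < alpha * (N%:R * (delta + t)))%R by rewrite !mulr_gt0// addr_gt0.
  by nra.
apply: (@le_trans _ _ (P D0 + P D1 + P D2 + P D3)).
  apply: le_trans (le_measure _ _ _ sub) _; rewrite ?inE//.
  - exact: measurableC measurable_miscoverage.
  - by do 2!(apply: measurableU => //); exact: measurableU.
  apply: le_trans (measureU2 _ _ _) _ => //; first by do 2!apply: measurableU => //.
  rewrite leeD2r//; apply: le_trans (measureU2 _ _ _) _ => //; first exact: measurableU.
  by rewrite leeD2r//; exact: measureU2.
have h1 : P D1 <= eps%:E.
  by apply: dev_le; apply: sub_gaussianN; exact: lambda_sub_gaussian.
have h2 : P D2 <= eps%:E by apply: dev_le; exact: sub_gaussian_density.
rewrite PD0 PD3 leeD2r//; apply: le_trans (leeD (leeD (lexx _) h1) h2) _.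
rewrite -!EFinD lee_fin /s; lra.
Qed.

End coverage.

(** * Choice of the thresholds and numerical constants *)

Lemma expR1_le4 (R : realType) : (expR 1 <= 4 :> R)%R.
Proof.
have := expR_ge1Dx (- 2^-1 : R); rewrite expRN.
rewrite (_ : 1 + - 2^-1 = 2^-1 :> R)%R; last by lra.
rewrite lef_pV2 ?posrE ?expR_gt0// => e2.
rewrite [X in expR X](_ : 1 = 2%:R * 2^-1 :> R)%R; last by lra.
rewrite expRM_natl (_ : 4 = 2 ^+ 2 :> R)%R; last by lra.
by rewrite lerXn2r ?nnegrE ?expR_ge0.
Qed.

Section miscoverage_bound.
Context (R : realType) (dO d : measure_display) (Omega : measurableType dO)
  (T : measurableType d) (P : probability Omega R) (N : nat) (hN : (0 < N)%N).
Variables (V lambda : {mfun T >-> R}) (Z : 'I_N.+1 -> {mfun Omega >-> T})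
  (Q : 'I_N.+1 -> probability T R) (alpha sigma : R).
Hypothesis Z_indep : mutually_independent P (fun k => Z k : Omega -> T).
Hypothesis Z_law : forall k A, measurable A ->
  distribution P (Z k) A = Q k A.
Hypothesis lambda_ge0 : forall z, (0 <= lambda z)%R.
Local Notation cal := (average hN (calibration Q)).
Hypothesis lambda_density : forall A, measurable A ->
  \int[cal]_(x in A) (lambda x)%:E = Q ord_max A.
Hypothesis no_ties : {ae P, forall w, forall k : 'I_N,
  V (calibration Z k w) <> V (Z ord_max w)}.
Hypothesis sigma_ge0 : (0 <= sigma)%R.
Hypothesis lambda_sub_gaussian : forall v : R,
  sub_gaussian cal (fun z => lambda z * \1_[set z' | (V z' < v)%R] z -
    fine (Q ord_max [set z' | (V z' < v)%R]))%R sigma.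
Hypotheses (alpha_gt0 : (0 < alpha)%R) (alpha_lt1 : (alpha < 1)%R).

(* [sigma] is increased to [sigma + 1 / (N c)], with [c = sqrt (ln (4 N) / N)],
   so that the case [sigma = 0] needs no separate treatment; this costs a
   multiple of [1 / N]. The thresholds are [delta = 2 sigma c] and
   [t = 2 / N + 2 sigma c], for which [exp (- N delta^2 / (2 sigma^2))] is
   [exp (- 2 ln (4 N))]. *)
Lemma miscoverage_bound :
  (`| fine (P (miscoverage V lambda Z alpha)) - alpha | <=
    19 * sigma * Num.sqrt (ln (4 * N%:R) / N%:R) + 18 / N%:R)%R.
Proof.
set c : R := Num.sqrt _; set E := miscoverage _ _ _ _.
have n0 : (0 < N%:R :> R)%R by rewrite ltr0n.
have n1 : (1 <= N%:R :> R)%R by rewrite ler1n.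
have L1 : (1 <= ln (4 * N%:R) :> R)%R.
  rewrite -[X in (X <= _)%R](expRK 1%R) ler_ln ?posrE ?expR_gt0 ?mulr_gt0//.
  by apply: (le_trans (expR1_le4 R)); rewrite ler_peMr.
have L0 : (0 < ln (4 * N%:R) :> R)%R by exact: lt_le_trans L1.
have c2 : (N%:R * c ^+ 2 = ln (4 * N%:R))%R.
  rewrite sqr_sqrtr; last by rewrite divr_ge0// ltW.
  by rewrite mulrC divfK// gt_eqF.
have c0 : (0 < c)%R by rewrite sqrtr_gt0 divr_gt0// (lt_le_trans _ L1).
have Nc0 : (0 < N%:R * c)%R by rewrite mulr_gt0.
pose s : R := (sigma + (N%:R * c)^-1)%R.
have iNc0 : (0 < (N%:R * c)^-1)%R by rewrite invr_gt0.
have s0 : (0 < s)%R by rewrite ltr_wpDl.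
have sigs : (sigma <= s)%R by rewrite lerDl ltW.
have hs v := sub_gaussian_le sigs (lambda_sub_gaussian v).
have sc : (s * c = sigma * c + N%:R^-1)%R.
  by rewrite mulrDl invfM -mulrA mulVf ?mulr1// gt_eqF.
pose delta : R := (2 * s * c)%R.
have delta0 : (0 < delta)%R by rewrite !mulr_gt0.
(* The exponent is [- 2 N c ^ 2 = - 2 ln (4 N)], so the left side is
   [2 / (4 N) ^ 2 = 1 / (8 N ^ 2)]. *)
have epsle : (2 * expR (- (N%:R * delta ^+ 2 / (2 * s ^+ 2))) <= N%:R^-1)%R.
  rewrite (_ : _ / _ = 2%:R * ln (4 * N%:R))%R; last first.
    by rewrite -c2 /delta; field; exact: lt0r_neq0.
  rewrite -mulrN expRM_natl expRN lnK ?posrE ?mulr_gt0//.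
  rewrite invfM exprMn expr2.
  have i0 : (0 < N%:R^-1 :> R)%R by rewrite invr_gt0.
  have i1 : (N%:R^-1 <= 1 :> R)%R by rewrite invf_le1.
  have : (N%:R^-1 ^+ 2 <= N%:R^-1 :> R)%R by rewrite expr2 ler_piMl// ltW.
  lra.
have mE : measurable E by exact: measurable_miscoverage.
have up := miscoverage_le Z_indep Z_law lambda_ge0 lambda_density no_ties s0
  hs alpha_gt0 alpha_lt1 delta0.
pose t : R := ((2 + N%:R * delta) / N%:R)%R.
have t0 : (0 < t)%R by rewrite divr_gt0// addr_gt0// mulr_gt0.
have lo := coverage_le Z_indep Z_law lambda_ge0 lambda_density no_ties s0
  hs alpha_gt0 alpha_lt1 delta0 t0.
have Nd0 : (0 < N%:R * delta)%R by rewrite mulr_gt0.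
(* [N t = 2 + N delta] is the threshold of [density_tail] with [r = N delta]. Its bound is
   [8 s ^ 2 / (N delta) = 4 s c / ln (4 N)], and the logarithm is at least 1. *)
have tl : Q ord_max [set z | (N%:R * t < lambda z)%R] <= (4 * (s * c))%:E.
  rewrite (_ : N%:R * t = 2 + N%:R * delta)%R; last first.
    by rewrite /t mulrC divfK// gt_eqF.
  apply: le_trans (density_tail lambda_ge0 lambda_density s0 Nd0 _) _.
    exact: sub_gaussian_density hs.
  rewrite lee_fin ler_pdivrMr//.
  have -> : (4 * (s * c) * (N%:R * delta) = 8 * s ^+ 2 * (N%:R * c ^+ 2))%R.
    by rewrite /delta; ring.
  by rewrite c2 ler_peMr// mulr_ge0// sqr_ge0.
have Efin : P E \is a fin_num by exact: fin_num_measure.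
move: up lo; rewrite -/E probability_setC// -(fineK Efin).
set p := fine (P E); rewrite lee_fin => up lo.
have lo' : (1 - p <= 1 - alpha + 2 * delta + t + N%:R^-1 + 4 * (s * c))%R.
  rewrite -lee_fin EFinB; apply: (le_trans lo); rewrite [leRHS]EFinD leeD//.
  by rewrite lee_fin lerD2l.
have tE : (t = 2 * N%:R^-1 + delta)%R.
  by rewrite /t; field; exact: lt0r_neq0.
have i0 : (0 < N%:R^-1 :> R)%R by rewrite invr_gt0.
have deltaE : (delta = 2 * (sigma * c + N%:R^-1))%R by rewrite -sc /delta mulrA.
have sc0 : (0 <= sigma * c)%R by rewrite mulr_ge0// ltW.
have up' : (p <= alpha + 2 * delta + N%:R^-1)%R.
  by apply: (le_trans up); rewrite lerD2l.
(* In total, the excess over [alpha] is at most [4 sigma c + 5 / N] and the shortfall at most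
   [10 sigma c + 13 / N]. *)
rewrite tE deltaE sc in up' lo'; rewrite -mulrA /=.
by rewrite ler_norml; apply/andP; split; lra.
Qed.

End miscoverage_bound.

(** * Expected conditional miscoverage *)

Lemma generated_sigma_algebraT d' (Omega : Type) (T : measurableType d')
    (I : Type) (Z : I -> Omega -> T) : generated_sigma_algebra Z setT.
Proof.
rewrite /generated_sigma_algebra.
have [h0 hC _] := smallest_sigma_algebra setT
  (\bigcup_i preimage_set_system setT (Z i) measurable).
by have := hC _ h0; rewrite setD0.
Qed.

Theorem theorem2p2 (R : realType)
  (dO dX dY : measure_display) (Omega : measurableType dO)
  (X : measurableType dX) (Y : measurableType dY)
  (P : probability Omega R)
  (N : nat) (hN : (0 < N)%N)
  (V : {mfun (X * Y)%type >-> R}) (V_ge0 : forall z, (0 <= V z)%R)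
  (Z : 'I_N.+1 -> {mfun Omega >-> (X * Y)%type})
  (Z_indep : mutually_independent P (fun k => Z k : Omega -> (X * Y)%type))
  (Q : 'I_N.+1 -> probability (X * Y)%type R)
  (Z_law : forall k A, measurable A -> distribution P (Z k) A = Q k A)
  (Q_dom : Q ord_max `<< average hN (calibration Q))
  (lambda : {mfun (X * Y)%type >-> R}) (lambda_ge0 : forall z, (0 <= lambda z)%R)
  (lambdaE : ae_eq (average hN (calibration Q)) setT (EFin \o lambda)
     ('d (charge_of_finite_measure (Q ord_max))
        '/d (average hN (calibration Q))))
  (alpha : R) (alpha_gt0 : (0 < alpha)%R) (alpha_lt1 : (alpha < 1)%R)
  (no_ties : {ae P, forall w, injective (fun k : option 'I_N.+1 =>
     if k is Some i then (V (Z i w))%:E else +oo)})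
  (sigma : R) (sigma_ge0 : (0 <= sigma)%R)
  (hsigma : forall v : R,
     let W z := (lambda z * \1_[set z' | (V z' < v)%R] z)%R in
     sub_gaussian (average hN (calibration Q))
       (fun z => W z - fine 'E_(average hN (calibration Q))[W])%R sigma)
  (alphaD : Omega -> R)
  (alphaD_version : is_cond_probability P
     (generated_sigma_algebra
        (calibration (fun k => Z k : Omega -> (X * Y)%type)))
     [set w | ~ confidence_set V lambda (calibration (Z ^~ w)) alpha
                  (Z ord_max w).1 (Z ord_max w).2]
     alphaD) :
  `| 'E_P[alphaD] - alpha%:E | <=
    (19 * sigma * Num.sqrt (ln (4 * N%:R) / N%:R))%:E
    + 18%:E * 'E_P[fun w => (lambda (Z ord_max w) ^+ 2)%R] * (N%:R^-1)%:E.
Proof.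
pose cal : probability (X * Y)%type R := average hN (calibration Q).
have ml : measurable_fun setT (EFin \o lambda) by exact/measurable_EFinP.
(* [lambda] agrees almost everywhere with the Radon-Nikodym derivative, so both have the same
   integrals. *)
have lambda_density A : measurable A ->
    \int[cal]_(x in A) (lambda x)%:E = Q ord_max A.
  move=> mA; rewrite [RHS](Radon_Nikodym_integral
    (nu := charge_of_finite_measure (Q ord_max)) (mu := cal) Q_dom mA).
  apply: ae_eq_integral => //; first exact: measurable_funTS.
    by apply: measurable_funTS; apply: measurable_int; exact: Radon_Nikodym_integrable.
  exact: ae_eq_subset lambdaE.
have nt : {ae P, forall w, forall k : 'I_N,
    V (calibration Z k w) <> V (Z ord_max w)}.
  apply: filterS no_ties => w inj k Vk.
  have := inj (Some (widen_ord (leqnSn N) k)) (Some ord_max).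
  move=> /(_ (congr1 EFin Vk)) [] /eqP.
  by rewrite ltn_eqF.
(* The centring constant, a mean under [cal], becomes a mass under [Q ord_max] through the
   density. *)
have hs v : sub_gaussian cal
    (fun z => lambda z * \1_[set z' | (V z' < v)%R] z -
    fine (Q ord_max [set z' | (V z' < v)%R]))%R sigma.
  have mV : measurable [set z' | (V z' < v)%R] by exact: measurable_score_lt.
  rewrite -lambda_density// integral_mkcond.
  have := hsigma v; rewrite /= unlock.
  congr (sub_gaussian _ _ _); apply/funext => z; congr (_ - fine _)%R.
  by apply: eq_integral => x _; rewrite epatch_indic EFinM.
have mE := measurable_miscoverage V lambda Z alpha.
(* Total probability: the whole space belongs to the generated sigma-algebra, so the conditional
   probability integrates to the probability of non-coverage. *)
have PE : 'E_P[alphaD] = P (miscoverage V lambda Z alpha).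
  case: alphaD_version => _ _ hint; rewrite unlock hint; last first.
    exact: generated_sigma_algebraT.
  congr (P _); rewrite setTI; apply/seteqP; split => w /=.
    by move=> /(not_confidence_set _ _ lambda_ge0 _ _ alpha_lt1); rewrite -surjective_pairing.
  move=> h; apply/(not_confidence_set _ _ lambda_ge0 _ _ alpha_lt1).
  by rewrite -surjective_pairing.
have bound := miscoverage_bound Z_indep Z_law lambda_ge0 lambda_density nt
  sigma_ge0 hs alpha_gt0 alpha_lt1.
rewrite PE -(fineK (fin_num_measure P _ mE)) -EFinB abse_EFin.
move: bound; rewrite -lee_fin => /le_trans; apply.
rewrite EFinD leeD2l//.
have m2 : measurable_fun setT (fun x => ((lambda x) ^+ 2)%:E : \bar R).
  by apply/measurable_EFinP; exact: measurable_funX.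
rewrite unlock (integral_law Z_law _ m2); last by move=> y; rewrite lee_fin sqr_ge0.
(* A second moment of at least 1 turns the remainder [18 / N] into the stated term. *)
have := density_second_moment_ge1 lambda_ge0 lambda_density.
rewrite EFinM => h; apply: lee_wpmul2r; first by rewrite lee_fin.
by rewrite -[leLHS]mule1 lee_wpmul2l.
Qed.
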